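(* Let $\kappa$ be an uncountable cardinal. The following are equivalent: (i) there is a finitely additive regular probability measure on $\kappa$ (defined on all subsets of $\kappa$) which vanishes on singletons; (ii) there is a regular singular state on $l^\infty(\kappa)$; (iii) there is a regular singular state on $B(l^2(\kappa))$.
   Context: A finitely additive measure is regular if the union of any countable family of null sets is null. A state $\phi$ on a von Neumann algebra is regular if whenever $\{q_n\}$ is a countable set of projections with $\phi(q_n)=0$ for all $n$, then $\phi(\bigvee q_n)=0$. A state on $l^\infty(\kappa)$ is singular if it vanishes on finitely supported functions; a state on $B(l^2(\kappa))$ is singular if it vanishes on the compact operators. *)

(* Defs.v *)
From HB Require Import structures.
From mathcomp Require Import all_boot all_order all_algebra.
From mathcomp Require Import all_classical all_reals.
From mathcomp Require Import ereal topology normedtype sequences esum.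
From mathcomp Require Import complex.

Set Implicit Arguments.
Unset Strict Implicit.
Unset Printing Implicit Defensive.

Import Order.TTheory GRing.Theory Num.Theory.
Import numFieldNormedType.Exports.
Local Open Scope classical_set_scope.
Local Open Scope ring_scope.

Section Defs.
Variables (R : realType) (K : choiceType).

Local Notation C := (complex R).
Local Notation normc := (@ComplexField.Normc.normc R).

Definition fa_probability (mu : set K -> R) : Prop :=
  (forall A, 0 <= mu A) /\ mu setT = 1 /\
  (forall A B, A `&` B = set0 -> mu (A `|` B) = mu A + mu B).

Definition vanishes_on_singletons (mu : set K -> R) : Prop :=
  forall x, mu [set x] = 0.

Definition regular_measure (mu : set K -> R) : Prop :=
  forall A : nat -> set K, (forall n, mu (A n) = 0) ->
    mu (\bigcup_n A n) = 0.

Definition linf_bounded (f : K -> C) : Prop :=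
  exists M : R, forall x, normc (f x) <= M.

Definition linf_state (phi : (K -> C) -> C) : Prop :=
  (forall (a : C) f g, linf_bounded f -> linf_bounded g ->
     phi (fun x => a * f x + g x) = a * phi f + phi g) /\
  (forall f, linf_bounded f -> (forall x, 0 <= f x) -> 0 <= phi f) /\
  phi (fun _ => 1) = 1.

Definition linf_proj (p : K -> C) : Prop :=
  linf_bounded p /\ (forall x, conjc (p x) = p x) /\
  (forall x, p x * p x = p x).

Definition linf_proj_le (p q : K -> C) : Prop := forall x, p x * q x = p x.

Definition linf_proj_sup (q : nat -> K -> C) (p : K -> C) : Prop :=
  linf_proj p /\ (forall n, linf_proj_le (q n) p) /\
  (forall r, linf_proj r -> (forall n, linf_proj_le (q n) r) ->
     linf_proj_le p r).

Definition linf_regular (phi : (K -> C) -> C) : Prop :=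
  forall q : nat -> K -> C, (forall n, linf_proj (q n)) ->
    (forall n, phi (q n) = 0) ->
    forall p, linf_proj_sup q p -> phi p = 0.

Definition linf_singular (phi : (K -> C) -> C) : Prop :=
  forall f, finite_set [set x | f x != 0] -> phi f = 0.

Definition sqnorm2 (f : K -> C) : \bar R :=
  \esum_(x in [set: K]) ((normc (f x)) ^+ 2)%:E.

Definition in_l2 (f : K -> C) : Prop := (sqnorm2 f < +oo)%E.

Definition norm2 (f : K -> C) : R := Num.sqrt (fine (sqnorm2 f)).

(* sum of an absolutely summable real family *)
Definition rsum (g : K -> R) : R :=
  fine (\esum_(x in [set: K]) (Num.max (g x) 0)%:E) -
  fine (\esum_(x in [set: K]) (Num.max (- g x) 0)%:E).

Definition inner (f g : K -> C) : C :=
  Complex (rsum (fun x => complex.Re (f x * conjc (g x))))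
          (rsum (fun x => complex.Im (f x * conjc (g x)))).

Definition op := (K -> C) -> (K -> C).

Definition bounded_op (T : op) : Prop :=
  (forall f, in_l2 f -> in_l2 (T f)) /\
  (forall (a : C) f g, in_l2 f -> in_l2 g ->
     T (fun x => a * f x + g x) = (fun x => a * T f x + T g x)) /\
  (exists M : R, forall f, in_l2 f -> norm2 (T f) <= M * norm2 f).

Definition B_state (phi : op -> C) : Prop :=
  (forall (a : C) S T, bounded_op S -> bounded_op T ->
     phi (fun f x => a * S f x + T f x) = a * phi S + phi T) /\
  (forall T, bounded_op T -> (forall f, in_l2 f -> 0 <= inner (T f) f) ->
     0 <= phi T) /\
  phi id = 1.

Definition B_proj (P : op) : Prop :=
  bounded_op P /\ (forall f, in_l2 f -> P (P f) = P f) /\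
  (forall f g, in_l2 f -> in_l2 g -> inner (P f) g = inner f (P g)).

Definition B_proj_le (P Q : op) : Prop := forall f, in_l2 f -> P (Q f) = P f.

Definition B_proj_sup (Q : nat -> op) (P : op) : Prop :=
  B_proj P /\ (forall n, B_proj_le (Q n) P) /\
  (forall S, B_proj S -> (forall n, B_proj_le (Q n) S) -> B_proj_le P S).

Definition B_regular (phi : op -> C) : Prop :=
  forall Q : nat -> op, (forall n, B_proj (Q n)) ->
    (forall n, phi (Q n) = 0) ->
    forall P, B_proj_sup Q P -> phi P = 0.

Definition compact_op (T : op) : Prop :=
  bounded_op T /\
  forall u : nat -> K -> C, (forall n, in_l2 (u n)) ->
    (exists M : R, forall n, norm2 (u n) <= M) ->
    exists (s : nat -> nat) (g : K -> C),
      (forall n, (s n < s n.+1)%N) /\ in_l2 g /\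
      (fun k => norm2 (fun x => T (u (s k)) x - g x)) @ \oo --> (0 : R).

Definition B_singular (phi : op -> C) : Prop :=
  forall T, compact_op T -> phi T = 0.

End Defs.

(* Main.v *)
(** A finitely additive probability [mu] integrates every bounded function, and
    this integral is the state on l^oo(K) attached to [mu]; conversely a state
    restricts to a measure on indicator functions, or, for operators, on the
    coordinate projections.  To pass from [mu] to B(l^2(K)), integrate the
    diagonal x |-> <T e_x, e_x>.  If projections Q_n all have integral zero, then
    by regularity, off a single null set, all Q_n kill e_x, so their supremum
    kills e_x too and its diagonal vanishes almost everywhere.  A compact
    operator has only finitely many diagonal entries above any threshold, so its
    diagonal is supported on a countable set, which is null. *)

Require Import Defs.
From HB Require Import structures.
From mathcomp Require Import all_boot all_order all_algebra.
From mathcomp Require Import all_classical all_reals.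
From mathcomp Require Import ereal topology normedtype sequences esum numfun.
From mathcomp Require Import complex.
From mathcomp Require Import finmap ring lra.

Import Order.TTheory GRing.Theory Num.Theory.
Import numFieldNormedType.Exports.

Local Open Scope classical_set_scope.
Local Open Scope ring_scope.

Local Notation normc := ComplexField.Normc.normc.

(** * Finitely additive probabilities and integrals of simple functions *)

Section FinitelyAdditive.
Context {R : realType} {K : choiceType}.
Variable mu : set K -> R.
Hypothesis mu_prob : fa_probability mu.

Lemma fa_ge0 A : 0 <= mu A.
Proof. by case: mu_prob. Qed.

Lemma fa_setT : mu setT = 1.
Proof. by case: mu_prob => _ []. Qed.

Lemma fa_setU A B : A `&` B = set0 -> mu (A `|` B) = mu A + mu B.
Proof. by case: mu_prob => _ [] _; apply. Qed.

Lemma fa_set0 : mu set0 = 0.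
Proof.
have := fa_setU set0 set0 (setI0 _); rewrite setU0 => /eqP.
by rewrite -subr_eq subrr => /eqP.
Qed.

Lemma fa_setID A B : mu A = mu (A `&` B) + mu (A `\` B).
Proof.
rewrite -fa_setU ?setUIDK//.
by rewrite setDE setIACA setICr setI0.
Qed.

(* A list [:: (a_1, A_1); ...] stands for the simple function a_1 1_{A_1} + ...,
   with no disjointness imposed on the A_i: sums of simple functions are then
   mere concatenations. *)
Definition sval (s : seq (R * set K)) (x : K) : R :=
  \sum_(p <- s) p.1 * \1_(p.2) x.

Definition sint (s : seq (R * set K)) : R := \sum_(p <- s) p.1 * mu p.2.

Definition sscale (c : R) (s : seq (R * set K)) := [seq (c * p.1, p.2) | p <- s].

Lemma sval_cat s t x : sval (s ++ t) x = sval s x + sval t x.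
Proof. exact: big_cat. Qed.

Lemma sint_cat s t : sint (s ++ t) = sint s + sint t.
Proof. exact: big_cat. Qed.

Lemma sval_scale c s x : sval (sscale c s) x = c * sval s x.
Proof.
by rewrite /sval big_map mulr_sumr; apply: eq_bigr => p _; rewrite /= mulrA.
Qed.

Lemma sint_scale c s : sint (sscale c s) = c * sint s.
Proof.
by rewrite /sint big_map mulr_sumr; apply: eq_bigr => p _; rewrite /= mulrA.
Qed.

Lemma sval1 c A x : sval [:: (c, A)] x = c * \1_A x.
Proof. exact: big_seq1. Qed.

Lemma sint1 c A : sint [:: (c, A)] = c * mu A.
Proof. exact: big_seq1. Qed.

(* Localising at a set [B] on which a constant [c] has already been collected
   lets the induction split [B] along the head set of the list. *)
Lemma sint_ge0_on s : forall c B, (forall x, B x -> 0 <= c + sval s x) ->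
  0 <= c * mu B + \sum_(p <- s) p.1 * mu (B `&` p.2).
Proof.
elim: s => [|[a A] s IH] c B sB.
  rewrite big_nil addr0; have [->|/set0P[x Bx]] := eqVneq B set0.
    by rewrite fa_set0 mulr0.
  by have := sB x Bx; rewrite /sval big_nil addr0 => c0; rewrite mulr_ge0// fa_ge0.
have I1 := IH (c + a) (B `&` A); have I2 := IH c (B `\` A).
rewrite big_cons /=.
have -> : c * mu B + (a * mu (B `&` A) + \sum_(j <- s) j.1 * mu (B `&` j.2)) =
  ((c + a) * mu (B `&` A) + \sum_(p <- s) p.1 * mu (B `&` A `&` p.2)) +
  (c * mu (B `\` A) + \sum_(p <- s) p.1 * mu ((B `\` A) `&` p.2)).
  have -> : \sum_(j <- s) j.1 * mu (B `&` j.2) =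
      \sum_(p <- s) p.1 * mu (B `&` A `&` p.2) +
      \sum_(p <- s) p.1 * mu ((B `\` A) `&` p.2).
    rewrite -big_split; apply: eq_bigr => p _ /=.
    by rewrite (fa_setID (B `&` p.2) A) mulrDr !setDE (setIAC B A) (setIAC B (~` A)).
  by rewrite (fa_setID B A); ring.
apply: addr_ge0; [apply: I1|apply: I2] => x [Bx Ax]; have := sB x Bx.
  by rewrite /sval big_cons /= indicE mem_set// mulr1 addrA.
by rewrite /sval big_cons /= indicE memNset// mulr0 add0r.
Qed.

Lemma sint_ge0 s : (forall x, 0 <= sval s x) -> 0 <= sint s.
Proof.
move=> s0; have := @sint_ge0_on s 0 setT.
rewrite mul0r add0r /sint; under eq_bigr do rewrite setTI.
by apply => x _; rewrite add0r.
Qed.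

Lemma sint_le s t : (forall x, sval s x <= sval t x) -> sint s <= sint t.
Proof.
move=> st; rewrite -subr_ge0 -[- _]mulN1r -sint_scale -sint_cat.
apply: sint_ge0 => x.
by rewrite sval_cat sval_scale mulN1r subr_ge0.
Qed.

(** * The integral of a bounded real function *)

Definition bounded_real (f : K -> R) := exists M, forall x, `|f x| <= M.

(** Binary expansion: subtracting [M / 2] where [f] exceeds [M / 2] leaves a function with values in
    [[0, M / 2]], so each step extracts one dyadic digit and halves the error. *)
Lemma simple_approx n (f : K -> R) M : (forall x, 0 <= f x <= M) ->
  exists s, forall x, sval s x <= f x <= sval s x + M / 2 ^+ n.
Proof.
elim: n f M => [|n IH] f M fM.
  by exists [::] => x; rewrite /sval big_nil add0r expr0 divr1.
pose A := [set x | M / 2 < f x].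
have [x|s sh] := IH (fun x => f x - M / 2 * \1_A x) (M / 2).
  have := fM x; have [Ax|Ax] := pselect (A x).
    by rewrite indicE mem_set// mulr1; move: Ax; rewrite /A /=; lra.
  rewrite indicE memNset// mulr0 subr0; move/negP: Ax; rewrite -leNgt; lra.
exists ((M / 2, A) :: s) => x; have := sh x.
by rewrite -cat1s sval_cat sval1 exprS invfM mulrA; lra.
Qed.

(** These are the upper sums of [f], and their infimum is an upper Darboux integral. For bounded
    [f], uniform approximation by simple functions and total mass 1 make it agree with the lower
    integral, which is where linearity comes from. *)
Definition above (f : K -> R) : set R :=
  [set sint s | s in [set s | forall x, f x <= sval s x]].

Definition integral (f : K -> R) : R := inf (above f).

Lemma above_nonempty {f} : bounded_real f -> above f !=set0.
Proof.
move=> [M fM]; exists (sint [:: (M, setT)]); exists [:: (M, setT)] => //= x.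
by rewrite sval1 indicT mulr1 (le_trans _ (fM x))// ler_norm.
Qed.

Lemma above_lbound {f} s : (forall x, sval s x <= f x) -> lbound (above f) (sint s).
Proof.
by move=> sf _ [t /= ft <-]; apply: sint_le => x; apply: le_trans (ft x).
Qed.

Lemma above_has_inf {f} : bounded_real f -> has_inf (above f).
Proof.
move=> bf; split; first exact: above_nonempty.
case: bf => M fM; exists (sint [:: (- M, setT)]); apply: above_lbound => x.
rewrite sval1 indicT mulr1; have := fM x; rewrite ler_norml; lra.
Qed.

Lemma integral_le_sint f s : bounded_real f -> (forall x, f x <= sval s x) ->
  integral f <= sint s.
Proof. by move=> bf fs; apply: ge_inf; [case: (above_has_inf bf)|exists s]. Qed.

Lemma sint_le_integral f s : bounded_real f -> (forall x, sval s x <= f x) ->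
  sint s <= integral f.
Proof.
by move=> bf sf; apply: lb_le_inf; [exact: above_nonempty|exact: above_lbound].
Qed.

Lemma bounded_realD f g : bounded_real f -> bounded_real g ->
  bounded_real (fun x => f x + g x).
Proof.
move=> [M fM] [N gN]; exists (M + N) => x.
by rewrite (le_trans (ler_normD _ _))// lerD.
Qed.

Lemma bounded_realZ c f : bounded_real f -> bounded_real (fun x => c * f x).
Proof.
by move=> [M fM]; exists (`|c| * M) => x; rewrite normrM ler_wpM2l.
Qed.

(** Total mass 1 turns a uniform error [e] into an error of at most [e] in the integral. This is the
    tool for computing integrals: it suffices to exhibit simple functions close to [f] from below
    with integrals close to [a]. *)
Lemma integral_unique f a : bounded_real f ->
  (forall e, 0 < e -> exists s, (forall x, sval s x <= f x <= sval s x + e)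
      /\ `|sint s - a| <= e) ->
  integral f = a.
Proof.
move=> bf H; apply/eqP; rewrite eq_le; apply/andP; split; apply/ler_addgt0Pl => e e0.
  (* The upper bound pays twice, for the gap between [s] and [f] and for the gap between [sint s]
     and [a]; the lower bound below pays only for the second, so [e] itself suffices there. *)
  have [s [fs]] := H (e / 2) ltac:(lra); rewrite ler_norml => sa.
  have : integral f <= sint (s ++ [:: (e / 2, setT)]).
    by apply: integral_le_sint => // x; have := fs x;
      rewrite sval_cat sval1 indicT mulr1 => /andP[].
  by rewrite sint_cat sint1 fa_setT; lra.
have [s [fs]] := H e e0; rewrite ler_norml => sa.
have : sint s <= integral f.
  by apply: sint_le_integral => // x; have /andP[] := fs x.
lra.
Qed.

Lemma integral_approx f e : bounded_real f -> 0 < e ->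
  exists s, (forall x, sval s x <= f x <= sval s x + e)
    /\ sint s <= integral f <= sint s + e.
Proof.
move=> bf e0.
have [s fs] : exists s, forall x, sval s x <= f x <= sval s x + e.
  case: bf => M fM.
  (* Shifting by [M] gives the nonnegative function that dyadic approximation requires; the constant
     term [(- M, setT)] undoes the shift. *)
  have f0 x : 0 <= f x + M <= 2 * `|M|.
    by have := fM x; rewrite ler_norml; have := ler_norm M; lra.
  have [n Mn] : exists n, 2 * `|M| / 2 ^+ n <= e.
    have half1 : `|2^-1 : R| < 1 by rewrite ger0_norm; lra.
    have /cvgrPdist_le/(_ e e0)[n _ /(_ n)] := cvg_geometric (2 * `|M|) half1.
    rewrite /= leqnn sub0r normrN => /(_ isT) /(le_trans (ler_norm _)).
    by rewrite exprVn; exists n.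
  have [s fs] := simple_approx n _ _ f0.
  exists ((- M, setT) :: s) => x; have := fs x.
  by rewrite -cat1s sval_cat sval1 indicT mulr1; lra.
exists s; split=> //; apply/andP; split.
  by apply: sint_le_integral => // x; have /andP[] := fs x.
have := integral_le_sint f (s ++ [:: (e, setT)]) bf.
rewrite sint_cat sint1 fa_setT mulr1; apply => x.
by rewrite sval_cat sval1 indicT mulr1; have /andP[] := fs x.
Qed.

Lemma integralD f g : bounded_real f -> bounded_real g ->
  integral (fun x => f x + g x) = integral f + integral g.
Proof.
move=> bf bg; apply: integral_unique; first exact: bounded_realD.
move=> e e0; have e20 : 0 < e / 2 by lra.
have [s [sf sif]] := integral_approx _ _ bf e20.
have [t [tg tig]] := integral_approx _ _ bg e20.
exists (s ++ t); split.
  by move=> x; rewrite sval_cat; have := sf x; have := tg x; lra.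
by rewrite sint_cat ler_norml; lra.
Qed.

Lemma integralN f : bounded_real f -> integral (fun x => - f x) = - integral f.
Proof.
move=> bf; apply: integral_unique.
  by case: bf => M fM; exists M => x; rewrite normrN.
move=> e e0; have [s [sf sif]] := integral_approx _ _ bf e0.
(* Negation exchanges the two sides of the approximation, so the constant [e] must be subtracted to
   get below [- f] again. *)
exists (sscale (-1) s ++ [:: (- e, setT)]); split.
  move=> x; rewrite sval_cat sval_scale sval1 indicT mulr1; have := sf x; lra.
by rewrite sint_cat sint_scale sint1 fa_setT ler_norml; lra.
Qed.

Lemma integral_sval s f : bounded_real f -> (forall x, f x = sval s x) ->
  integral f = sint s.
Proof.
move=> bf fs; apply: integral_unique => // e e0; exists s; split.
  by move=> x; rewrite fs; lra.
by rewrite subrr normr0 ltW.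
Qed.

Lemma integralZ c f : bounded_real f -> integral (fun x => c * f x) = c * integral f.
Proof.
move=> bf; wlog c0 : c / 0 <= c.
  move=> H; have [/H//|/ltW c0] := leP 0 c.
  rewrite -[RHS]opprK -mulNr -H ?oppr_ge0//.
  rewrite -integralN; first by congr integral; apply/funext => x; rewrite mulNr opprK.
  exact: bounded_realZ.
apply: integral_unique; first exact: bounded_realZ.
move=> e e0.
have c1 : 0 < c + 1 by lra.
(* Dividing by [c + 1] instead of [c] covers [c = 0] as well. *)
have [s [sf sif]] := integral_approx _ _ bf (divr_gt0 e0 c1).
have de : c * (e / (c + 1)) <= e.
  by rewrite mulrA ler_pdivrMr//; nra.
exists (sscale c s); split.
  by move=> x; rewrite sval_scale; have := sf x; nra.
by rewrite sint_scale ler_norml; nra.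
Qed.

Lemma integral_ge0 f : bounded_real f -> (forall x, 0 <= f x) -> 0 <= integral f.
Proof.
move=> bf f0; have := sint_le_integral f [::] bf.
by rewrite /sint big_nil; apply=> x; rewrite /sval big_nil.
Qed.

Lemma bounded_real_indic A : bounded_real (\1_A : K -> R).
Proof. by exists 1 => x; rewrite indicE; case: (_ \in _); rewrite ?normr1 ?normr0. Qed.

Lemma integral_indic A : integral (\1_A : K -> R) = mu A.
Proof.
rewrite (integral_sval [:: (1, A)]) ?sint1 ?mul1r//; first exact: bounded_real_indic.
by move=> x; rewrite sval1 mul1r.
Qed.

(** If [M] bounds [|f|], then [f] lies between the simple functions [- M] and [M] times the
    indicator of [A], both of integral zero. *)
Lemma integral_null_support f A : bounded_real f -> mu A = 0 ->
  (forall x, ~ A x -> f x = 0) -> integral f = 0.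
Proof.
move=> bf A0 fA; have [M fM] := bf; apply/eqP; rewrite eq_le; apply/andP; split.
  have := integral_le_sint f [:: (M, A)] bf; rewrite sint1 A0 mulr0; apply => x.
  have [Ax|Ax] := pselect (A x).
    by rewrite sval1 indicE mem_set// mulr1 (le_trans (ler_norm _)).
  by rewrite sval1 indicE memNset// mulr0 fA.
have := sint_le_integral f [:: (- M, A)] bf; rewrite sint1 A0 mulr0; apply => x.
have [Ax|Ax] := pselect (A x).
  by rewrite sval1 indicE mem_set// mulr1 lerNl (le_trans (ler_norm _))// normrN.
by rewrite sval1 indicE memNset// mulr0 fA.
Qed.

(** * Consequences of regularity for null sets *)

Lemma fa_levels (f : K -> R) : regular_measure mu ->
  (forall e, 0 < e -> mu [set x | e < f x] = 0) -> mu [set x | 0 < f x] = 0.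
Proof.
move=> mu_reg H.
have -> : [set x | 0 < f x] = \bigcup_n [set x | n.+1%:R^-1 < f x].
  apply/seteqP; split=> x /=; last by move=> [n _ /=]; apply: lt_trans; rewrite invr_gt0.
  move=> fx; have [n nf] := ltr_add_invr (fx); exists n => //=.
  by rewrite add0r in nf.
by apply: mu_reg => n; apply: H; rewrite invr_gt0.
Qed.

(** Markov's inequality: [e] times the indicator of [f > e] lies below [f], so every level set is
    null, and regularity collects the levels. *)
Lemma integral_eq0 f : regular_measure mu -> bounded_real f -> (forall x, 0 <= f x) ->
  integral f = 0 -> mu [set x | 0 < f x] = 0.
Proof.
move=> mu_reg bf f0 if0; apply: fa_levels => // e e0.
have := sint_le_integral f [:: (e, [set x | e < f x])] bf.
rewrite sint1 if0 => /(_ _)H; apply/eqP; rewrite eq_le fa_ge0 andbT.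
rewrite -(pmulr_rle0 _ e0) H// => x; rewrite sval1.
have [ex|ex] := pselect (e < f x); first by rewrite indicE mem_set// mulr1 ltW.
by rewrite indicE memNset// mulr0.
Qed.

Lemma fa_countable A : regular_measure mu -> vanishes_on_singletons mu ->
  countable A -> mu A = 0.
Proof.
move=> mu_reg mu1 /pfcard_geP[->|/unsquash g]; first exact: fa_set0.
have -> : A = \bigcup_n [set g n].
  apply/seteqP; split=> x.
    by move=> /(@surj _ _ _ _ g)[n _ <-]; exists n.
  by move=> [n _ ->]; apply: funS.
by apply: mu_reg => n; apply: mu1.
Qed.

End FinitelyAdditive.

(** * Modulus and positivity of complex numbers *)

Section ComplexFacts.
Context {R : realType}.
Implicit Types z w : complex R.

Lemma normc_sqr z : normc z ^+ 2 = complex.Re z ^+ 2 + complex.Im z ^+ 2.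
Proof. by case: z => a b; rewrite /= sqr_sqrtr// addr_ge0 ?sqr_ge0. Qed.

Lemma normc_ge0 z : 0 <= normc z.
Proof. by case: z => a b; exact: sqrtr_ge0. Qed.

Lemma norm_Re_le z : `|complex.Re z| <= normc z.
Proof. by case: z => a b /=; rewrite -sqrtr_sqr ler_wsqrtr// lerDl sqr_ge0. Qed.

Lemma norm_Im_le z : `|complex.Im z| <= normc z.
Proof. by case: z => a b /=; rewrite -sqrtr_sqr ler_wsqrtr// lerDr sqr_ge0. Qed.

Lemma normc_le_ReIm z : normc z <= `|complex.Re z| + `|complex.Im z|.
Proof.
rewrite -(@ler_pXn2r _ 2) ?nnegrE ?addr_ge0 ?normc_ge0// normc_sqr.
rewrite -(real_normK (num_real (complex.Re z))) -(real_normK (num_real (complex.Im z))).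
by have := normr_ge0 (complex.Re z); have := normr_ge0 (complex.Im z); nra.
Qed.

Lemma normcB_le z w : normc (z - w) <= normc z + normc w.
Proof. by rewrite -(normcN w); exact: le_normcD. Qed.

Lemma ge0_complexP z : reflect (complex.Im z = 0 /\ 0 <= complex.Re z) (0 <= z).
Proof. by rewrite lecE; apply: (iffP andP) => -[/eqP]. Qed.

Lemma ge0_Re_eq0 z : 0 <= z -> complex.Re z = 0 -> z = 0.
Proof. by case: z => a b /ge0_complexP[/= -> _ ->]. Qed.

Lemma mul_conjc_ge0 z : 0 <= z * conjc z.
Proof. by case: z => a b; apply/ge0_complexP; split; rewrite /=; [ring|nra]. Qed.

Lemma Re_mul_conjc z : complex.Re (z * conjc z) = normc z ^+ 2.
Proof. by rewrite normc_sqr; case: z => a b /=; ring. Qed.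

Lemma natr_bool_ge0 (b : bool) : (0 : complex R) <= b%:R.
Proof. exact: ler0n. Qed.

End ComplexFacts.

Lemma infinite_set_seq {T} {A : set T} : infinite_set A ->
  exists2 i : nat -> T, injective i & forall n, A (i n).
Proof.
(* An empty [T] has no infinite subset; otherwise [T] is pointed, and the injection is available as
   a total function. *)
elim/Ppointed: T => T in A *; first by rewrite emptyE => /(_ (finite_set0 _)).
move=> /infiniteP/pcard_leP/unsquash i; exists i.
  by move=> a b; apply: (@inj _ _ _ i); rewrite in_setT.
by move=> n; apply: (@funS _ _ _ _ i).
Qed.

(** * Unordered sums and square-summable families *)

Section SquareSummable.
Context {R : realType} {K : choiceType}.
Local Notation C := (complex R).
Implicit Types (f g : K -> C) (T : @op R K) (A : set K) (x : K).

Lemma esum_single (a : K -> \bar R) x : (0 <= a x)%E ->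
  (forall y, y != x -> a y = 0%E) -> \esum_(y in [set: K]) a y = a x.
Proof.
move=> ax0 a0; rewrite -[RHS](esum_set1 ax0) [RHS]esum_mkcond.
apply: eq_esum => y _; have [->|yx] := eqVneq y x; first by rewrite mem_set.
by rewrite memNset ?a0//= => /eqP; rewrite (negPf yx).
Qed.

Lemma rsum_single (g : K -> R) x : (forall y, y != x -> g y = 0) -> rsum g = g x.
Proof.
move=> g0; rewrite /rsum !(esum_single _ x) /=; last 4 first.
- by rewrite lee_fin le_max lexx orbT.
- by move=> y /g0 ->; rewrite oppr0 maxxx.
- by rewrite lee_fin le_max lexx orbT.
- by move=> y /g0 ->; rewrite maxxx.
by rewrite !maxEle; do !case: ifPn; lra.
Qed.

Lemma rsum0 : rsum (fun _ : K => 0) = 0 :> R.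
Proof. by rewrite /rsum oppr0 subrr. Qed.

Lemma rsum_nonneg (g : K -> R) : (forall x, 0 <= g x) ->
  rsum g = fine (\esum_(x in [set: K]) (g x)%:E).
Proof.
move=> g0; rewrite /rsum [X in _ - fine X]esum1 ?subr0.
  by congr fine; apply: eq_esum => x _; rewrite max_l.
by move=> x _; rewrite max_r// oppr_le0.
Qed.

Lemma sqnorm2_ge0 f : (0 <= sqnorm2 f)%E.
Proof. by apply: esum_ge0 => x _; rewrite lee_fin sqr_ge0. Qed.

Lemma sqnorm2_fin f : in_l2 f -> sqnorm2 f \is a fin_num.
Proof. by move=> fl2; rewrite ge0_fin_numE// sqnorm2_ge0. Qed.

Lemma norm2_ge0 f : 0 <= norm2 f.
Proof. exact: sqrtr_ge0. Qed.

Lemma sqnorm2_le f g : (forall x, normc (f x) <= normc (g x)) ->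
  (sqnorm2 f <= sqnorm2 g)%E.
Proof.
move=> fg; apply: le_esum => x _; rewrite lee_fin.
by rewrite lerXn2r// nnegrE normc_ge0.
Qed.

Lemma in_l2_le f g : (forall x, normc (f x) <= normc (g x)) -> in_l2 g -> in_l2 f.
Proof. by move=> fg; apply: le_lt_trans; exact: sqnorm2_le. Qed.

Lemma norm2_le f g : (forall x, normc (f x) <= normc (g x)) -> in_l2 g ->
  norm2 f <= norm2 g.
Proof.
move=> fg gl2; apply: ler_wsqrtr; apply: fine_le; last exact: sqnorm2_le.
  by apply: sqnorm2_fin; exact: in_l2_le fg gl2.
exact: sqnorm2_fin.
Qed.

Lemma sqnorm2_single f x : (forall y, y != x -> f y = 0) ->
  sqnorm2 f = (normc (f x) ^+ 2)%:E.
Proof.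
move=> f0; rewrite /sqnorm2 (esum_single _ x)//; first by rewrite lee_fin sqr_ge0.
by move=> y /f0 ->; rewrite ComplexField.Normc.normc0 expr0n.
Qed.

Lemma norm2_single f x : (forall y, y != x -> f y = 0) -> norm2 f = normc (f x).
Proof.
move=> f0; rewrite /norm2 (sqnorm2_single _ x)//= sqrtr_sqr ger0_norm//.
exact: normc_ge0.
Qed.

Lemma in_l2_single f x : (forall y, y != x -> f y = 0) -> in_l2 f.
Proof. by move=> f0; rewrite /in_l2 (sqnorm2_single _ x)// ltry. Qed.

(** The truncation of [f] to the coordinate [x] is dominated by [f] and has norm exactly
    [normc (f x)]. *)
Lemma normc_le_norm2 f x : in_l2 f -> normc (f x) <= norm2 f.
Proof.
move=> fl2; pose g y := if y == x then f x else 0.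
have g0 y : y != x -> g y = 0 by rewrite /g => /negPf ->.
have gx : g x = f x by rewrite /g eqxx.
rewrite -gx -(norm2_single _ _ g0); apply: norm2_le => // y; rewrite /g.
case: eqP => [->//|_]; rewrite ComplexField.Normc.normc0; exact: normc_ge0.
Qed.

Lemma in_l2B f g : in_l2 f -> in_l2 g -> in_l2 (fun x => f x - g x).
Proof.
move=> fl2 gl2.
pose F x := (normc (f x) ^+ 2)%:E; pose G x := (normc (g x) ^+ 2)%:E.
have F0 x : [set: K] x -> (0 <= F x)%E by rewrite lee_fin sqr_ge0.
have G0 x : [set: K] x -> (0 <= G x)%E by rewrite lee_fin sqr_ge0.
have FG0 x : [set: K] x -> (0 <= F x + G x)%E by move=> ?; rewrite adde_ge0 ?F0 ?G0.
have FGfin : (\esum_(x in [set: K]) (F x + G x) < +oo)%E.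
  by rewrite esumD//; exact: lte_add_pinfty.
(* The sum is taken twice because [|a - b|^2 <= 2 (|a|^2 + |b|^2)]. *)
apply: le_lt_trans (lte_add_pinfty FGfin FGfin); rewrite -esumD//.
apply: le_esum => x _; rewrite /F /G -!EFinD lee_fin.
have : normc (f x - g x) ^+ 2 <= (normc (f x) + normc (g x)) ^+ 2.
  by rewrite lerXn2r ?nnegrE ?addr_ge0 ?normc_ge0// normcB_le.
by have := sqr_ge0 (normc (f x) - normc (g x)); nra.
Qed.

Lemma in_l2_level_finite f (e : R) : in_l2 f -> 0 < e ->
  finite_set [set x | e <= normc (f x)].
Proof.
move=> fl2 e0; apply: contrapT => /infinite_set_fset Dinf.
(* With infinitely many such points, any [n] of them already contribute [n e^2] to the squared norm;
   [n] is chosen to make this exceed the total. *)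
have [n nP] : exists n : nat, fine (sqnorm2 f) < n%:R * e ^+ 2.
  exists (Num.truncn (fine (sqnorm2 f) / e ^+ 2)).+1.
  by rewrite -ltr_pdivrMr ?exprn_gt0// truncnS_gt.
have [B BD nB] := Dinf n; move: nP; apply/negP; rewrite -leNgt.
rewrite -lee_fin fineK; last exact: sqnorm2_fin.
apply: esum_ge; exists [set` B]; first by split.
rewrite fsbig_finite//= set_fsetK sumEFin lee_fin.
apply: (@le_trans _ _ (\sum_(i <- B) e ^+ 2)).
  rewrite big_const_seq count_predT iter_addr_0 -[X in _ <= X]mulr_natl.
  by rewrite ler_wpM2r ?sqr_ge0// ler_nat.
rewrite big_seq [X in _ <= X]big_seq; apply: ler_sum => x /BD /= ex.
by rewrite lerXn2r// nnegrE ?normc_ge0// ltW.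
Qed.

(** * Basis vectors and inner products *)

Definition delta (x : K) : K -> C := fun y => (y == x)%:R.

Lemma delta_diag x : delta x x = 1.
Proof. by rewrite /delta eqxx. Qed.

Lemma delta_off x y : y != x -> delta x y = 0.
Proof. by rewrite /delta => /negPf ->. Qed.

Lemma in_l2_delta x : in_l2 (delta x).
Proof. exact: in_l2_single (@delta_off x). Qed.

Lemma norm2_delta x : norm2 (delta x) = 1.
Proof.
by rewrite (norm2_single _ _ (@delta_off x)) delta_diag ComplexField.Normc.normc1.
Qed.

Lemma inner_delta f x : inner f (delta x) = f x.
Proof.
have off y : y != x -> f y * conjc (delta x y) = 0.
  by move=> /delta_off ->; rewrite conjc0 mulr0.
rewrite /inner !(rsum_single _ x); last 2 first.
- by move=> y /off ->.
- by move=> y /off ->.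
by rewrite delta_diag conjc1 mulr1; case: (f x).
Qed.

Lemma inner_ge0 f g : (forall x, 0 <= f x * conjc (g x)) -> 0 <= inner f g.
Proof.
move=> fg0; apply/ge0_complexP; split; rewrite /inner /=.
  rewrite -[RHS]rsum0; congr rsum; apply/funext => x.
  by case/ge0_complexP: (fg0 x).
rewrite rsum_nonneg; last by move=> x; case/ge0_complexP: (fg0 x).
apply: fine_ge0; apply: esum_ge0 => x _; rewrite lee_fin.
by case/ge0_complexP: (fg0 x).
Qed.

Lemma inner_self_eq0 f : in_l2 f -> inner f f = 0 -> f = (fun=> 0).
Proof.
move=> fl2 /(congr1 (@complex.Re R)); rewrite /inner /=.
rewrite rsum_nonneg; last by move=> x; rewrite Re_mul_conjc sqr_ge0.
under eq_esum do rewrite Re_mul_conjc.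
move=> f0; apply/funext => x; apply: ComplexField.Normc.eq0_normc.
apply/eqP; rewrite eq_le normc_ge0 andbT (le_trans (normc_le_norm2 f x fl2))//.
by rewrite /norm2 /sqnorm2 f0 sqrtr0.
Qed.

(** Linearity with [a = 1] and both vectors zero gives [T 0 = T 0 + T 0]. *)
Lemma bounded_op0 T : bounded_op T -> T (fun=> 0) = (fun=> 0).
Proof.
case=> _ [Tlin _]; apply/funext => x.
have l20 : in_l2 (fun _ : K => 0 : C).
  by rewrite /in_l2 (sqnorm2_single _ x)// ltry.
have /(congr1 (fun h : K -> C => h x)) := Tlin 1 _ _ l20 l20.
under eq_fun do rewrite mulr0 addr0.
by rewrite mul1r => /eqP; rewrite -subr_eq subrr => /eqP.
Qed.

(** * Coordinate projections and their compactness *)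

(** Multiplication by the indicator of [A], that is, the orthogonal projection onto l^2(A). These
    operators play in B(l^2(K)) the part that indicators play in l^oo(K). *)
Definition restriction A : @op R K := fun f x => (x \in A)%:R * f x.

Lemma normc_restriction A f x : normc (restriction A f x) <= normc (f x).
Proof.
rewrite /restriction; case: (x \in A); rewrite ?mul1r// mul0r.
rewrite ComplexField.Normc.normc0; exact: normc_ge0.
Qed.

Lemma restriction_bounded A : bounded_op (restriction A).
Proof.
split; first by move=> f; apply: in_l2_le => x; exact: normc_restriction.
split; first by move=> a f g _ _; apply/funext => x; rewrite /restriction; ring.
exists 1 => f fl2; rewrite mul1r; apply: norm2_le => // x.
exact: normc_restriction.
Qed.

Lemma restriction_proj A : B_proj (restriction A).
Proof.
split; first exact: restriction_bounded; split.
  move=> f _; apply/funext => x; rewrite /restriction.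
  by case: (x \in A); rewrite ?mul1r ?mul0r.
move=> f g _ _; rewrite /inner; congr Complex; congr rsum; apply/funext => x;
  by rewrite /restriction; case: (x \in A); rewrite ?mul1r// !mul0r conjc0 mulr0.
Qed.

Lemma restriction_positive A f : 0 <= inner (restriction A f) f.
Proof.
apply: inner_ge0 => x; rewrite /restriction -mulrA.
exact: mulr_ge0 (natr_bool_ge0 _) (mul_conjc_ge0 _).
Qed.

(** If [S] dominates every [restriction (A n)], then [S f] and [f] agree on each [A n], hence on the
    union. *)
Lemma restriction_sup (A : nat -> set K) :
  B_proj_sup (fun n => restriction (A n)) (restriction (\bigcup_n A n)).
Proof.
split; first exact: restriction_proj.
split=> [n f _|S _ AS f fl2]; apply/funext => x.
  rewrite /restriction; have [Ax|Ax] := pselect (A n x).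
    by rewrite (mem_set (_ : (\bigcup_n A n) x)) ?mul1r//; exists n.
  by rewrite memNset// !mul0r.
rewrite /restriction; have [[n _ Ax]|Ax] := pselect ((\bigcup_n A n) x).
  have /(congr1 (fun h : K -> C => h x)) := AS n f fl2.
  by rewrite /restriction (mem_set Ax) !mul1r => ->.
by rewrite memNset// !mul0r.
Qed.

(** Bolzano-Weierstrass is applied to the real parts, then to the imaginary parts along the
    subsequence obtained. *)
Lemma bounded_complex_cvg_subseq (z : nat -> C) (M : R) :
  (forall n, normc (z n) <= M) ->
  exists (s : nat -> nat) (l : C), (forall n, (s n < s n.+1)%N) /\
    (fun k => normc (z (s k) - l)) @ \oo --> (0 : R).
Proof.
move=> zM.
have bnd (u : nat -> R) : (forall n, `|u n| <= M) -> bounded_fun u.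
  move=> uM; exists M; split; first exact: num_real.
  by move=> y My n _ /=; rewrite (le_trans (uM n))// ltW.
have [s s_inc /cvg_ex[a sa]] := bolzano_weierstrass
  (bnd (fun n => complex.Re (z n)) (fun n => le_trans (norm_Re_le _) (zM n))).
have [t t_inc /cvg_ex[b tb]] := bolzano_weierstrass
  (bnd (fun n => complex.Im (z (s n))) (fun n => le_trans (norm_Im_le _) (zM _))).
have inc (r : nat -> nat) : {mono r : n m / (n <= m)%N >-> (n <= m)%O} ->
    forall n m, (n < m)%N -> (r n < r m)%N.
  by move=> /leW_mono r_inc n m nm; have := r_inc n m; rewrite ltEnat /= nm.
exists (s \o t), (Complex a b); split.
  by move=> n; exact: (inc s s_inc _ _ (inc t t_inc _ _ (ltnSn n))).
have ta : (fun n => complex.Re (z (s (t n)))) @ \oo --> a.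
  (* Since [t] is strictly increasing, [n <= t n]; so [t] tends to infinity and the limit of the
     real parts survives the second extraction. *)
  apply: (cvg_comp _ _ _ sa); apply/cvgnyPge => N; exists N => // n /= Nn.
  rewrite (leq_trans Nn)//; elim: n {Nn} => // n IH.
  by rewrite (leq_ltn_trans IH)// inc.
apply: (@squeeze_cvgr _ _ _ _ (fun=> 0)
  (fun n => `|complex.Re (z (s (t n))) - a| + `|complex.Im (z (s (t n))) - b|)).
- near=> n; rewrite normc_ge0 /= (le_trans (normc_le_ReIm _))//.
  by case: (z _).
- exact: cvg_cst.
- rewrite -[X in _ --> X](addr0 (0 : R)); apply: cvgD.
    rewrite -(normr0 R); apply: cvg_norm; rewrite -(subrr a); apply: cvgB => //.
    exact: cvg_cst.
  rewrite -(normr0 R); apply: cvg_norm; rewrite -(subrr b); apply: cvgB => //.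
  exact: cvg_cst.
Unshelve. all: by end_near. Qed.

(** The range is one-dimensional, so convergence of images reduces to convergence of the bounded
    scalars [u n x]. *)
Lemma restriction1_compact x : compact_op (restriction [set x]).
Proof.
split; first exact: restriction_bounded.
move=> u ul2 [M uM].
have [n|s [l [s_inc sl]]] := bounded_complex_cvg_subseq (fun n => u n x) M.
  exact: le_trans (normc_le_norm2 _ _ (ul2 n)) (uM n).
exists s, (fun y => delta x y * l); split=> //; split.
  by apply: (in_l2_single _ x) => y /delta_off ->; rewrite mul0r.
apply: cvg_trans sl; apply: near_eq_cvg; near=> k.
rewrite (norm2_single _ x); last first.
  move=> y yx; rewrite delta_off// mul0r /restriction memNset ?mul0r ?subr0//.
  by move=> /= /eqP; rewrite (negPf yx).
by rewrite delta_diag mul1r /restriction mem_set// mul1r.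
Unshelve. all: by end_near. Qed.

(** * Diagonals of operators, projections and compact operators *)

Definition diagonal T : K -> C := fun x => T (delta x) x.

Lemma diagonal_bounded T : bounded_op T -> linf_bounded (diagonal T).
Proof.
move=> [Tl2 [_ [M TM]]]; exists M => x.
rewrite (le_trans (normc_le_norm2 _ x (Tl2 _ (in_l2_delta x))))//.
by rewrite (le_trans (TM _ (in_l2_delta x)))// norm2_delta mulr1.
Qed.

Lemma diagonal_ge0 T : (forall f, in_l2 f -> 0 <= inner (T f) f) ->
  forall x, 0 <= diagonal T x.
Proof. by move=> T0 x; rewrite /diagonal -inner_delta T0//; exact: in_l2_delta. Qed.

(** Idempotence followed by self-adjointness. A diagonal entry of a projection is thus the squared
    norm of its column, so a zero entry forces a zero column. *)
Lemma proj_inner (Q : @op R K) f : B_proj Q -> in_l2 f ->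
  inner (Q f) f = inner (Q f) (Q f).
Proof.
move=> [[Ql2 _] [QQ Qsa]] fl2; rewrite -[in LHS]QQ//.
by rewrite Qsa//; exact: Ql2.
Qed.

Lemma diagonal_proj_ge0 (Q : @op R K) x : B_proj Q -> 0 <= diagonal Q x.
Proof.
move=> Qp; rewrite /diagonal -inner_delta proj_inner//; last exact: in_l2_delta.
by apply: inner_ge0 => y; exact: mul_conjc_ge0.
Qed.

Lemma diagonal_proj_eq0 (Q : @op R K) x : B_proj Q -> diagonal Q x = 0 ->
  Q (delta x) = (fun=> 0).
Proof.
move=> Qp; rewrite /diagonal -inner_delta proj_inner//; last exact: in_l2_delta.
by apply: inner_self_eq0; case: Qp => -[Ql2 _] _; apply: Ql2; exact: in_l2_delta.
Qed.

(* The projection onto the orthogonal complement of [delta x] dominates every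
   projection killing [delta x], hence also their supremum. *)
Lemma proj_sup_delta (Q : nat -> @op R K) P x : (forall n, B_proj (Q n)) ->
  B_proj_sup Q P -> (forall n, Q n (delta x) = (fun=> 0)) ->
  P (delta x) = (fun=> 0).
Proof.
move=> Qp [Pp [_ Pmin]] Qx; pose S := restriction (~` [set x]).
have Sx : S (delta x) = (fun=> 0).
  apply/funext => y; rewrite /S /restriction; have [->|yx] := eqVneq y x.
    by rewrite memNset ?mul0r// => /(_ erefl).
  by rewrite delta_off// mulr0.
have PS : B_proj_le P S.
  apply: Pmin; first exact: restriction_proj.
  move=> n f fl2; have [[_ [Qlin _]] _] := Qp n.
  have Sl2 : in_l2 (S f) by have [Sl2 _] := restriction_bounded (~` [set x]); apply: Sl2.
  (* Splitting off the [x] coordinate: [Q n] kills the first summand, so it takes the same value at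
     [f] and at [S f]. *)
  have {2}-> : f = (fun y => f x * delta x y + S f y).
    apply/funext => y; rewrite /S /restriction; have [->|yx] := eqVneq y x.
      by rewrite delta_diag memNset ?mul0r ?mulr1 ?addr0// => /(_ erefl).
    by rewrite delta_off// mulr0 add0r mem_set ?mul1r//= => /eqP; rewrite (negPf yx).
  rewrite Qlin//; last exact: in_l2_delta.
  by apply/funext => y; rewrite Qx mulr0 add0r.
rewrite -PS; last exact: in_l2_delta.
by rewrite Sx; apply: bounded_op0; case: Pp.
Qed.

(* If infinitely many diagonal entries were at least [e], a subsequence of the
   images of the corresponding basis vectors would converge to some [g] in l2
   that is not small at infinitely many points. *)
Lemma diagonal_compact_finite T (e : R) : compact_op T -> 0 < e ->
  finite_set [set x | e < normc (diagonal T x)].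
Proof.
move=> [[Tl2 _] Tcpt] e0; apply: contrapT => /infinite_set_seq[i iinj iD].
have [| |s [g [s_inc [gl2 Tg]]]] := Tcpt (fun n => delta (i n)).
- by move=> n; exact: in_l2_delta.
- by exists 1 => n; rewrite norm2_delta.
have e2 : 0 < e / 2 by rewrite divr_gt0.
have sinj : injective s.
  have s_lt a b : (a < b)%N -> (s a < s b)%N.
    elim: b => // b IH; rewrite ltnS leq_eqVlt => /orP[/eqP ->//|/IH].
    by move=> /ltn_trans; apply.
  move=> a b sab; case: (ltngtP a b) => // /s_lt; by rewrite sab ltnn.
have /cvgrPdist_lt/(_ _ e2)[N _ NP] := Tg.
(* The shift by [N] puts every index in the range where the distance to [g] is below [e / 2]. An
   entry of modulus above [e] then leaves [g] with modulus at least [e / 2], so all of nat would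
   inject into a finite level set of [g]. *)
apply: infinite_nat; apply: (@sub_finite_set _ _ ((fun k => i (s (k + N)%N)) @^-1`
    [set x | e / 2 <= normc (g x)])).
  move=> k _ /=; have := NP (k + N)%N (leq_addl _ _).
  set x := i _; rewrite sub0r normrN ger0_norm ?norm2_ge0// => Tgx.
  have := normc_le_norm2 _ x (in_l2B _ _ (Tl2 _ (in_l2_delta x)) gl2).
  rewrite /= -/x in Tgx * => /le_lt_trans/(_ Tgx) dx.
  have := iD (s (k + N)%N); rewrite /= -/x /diagonal => ex.
  have := le_normcD (T (delta x) x - g x) (g x); rewrite subrK.
  lra.
apply: finite_preimage; last exact: in_l2_level_finite.
by move=> a b _ _ /iinj/sinj/addIn.
Qed.

End SquareSummable.

(** * Indicators as projections of l^oo(K) *)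

Lemma linf_proj_indic (R : realType) (K : choiceType) (A : set K) :
  linf_proj (fun x => (x \in A)%:R : complex R).
Proof.
split; last by split=> x; case: (x \in A); rewrite ?conjc0 ?conjc1 ?mul1r ?mul0r.
exists 1 => x; case: (x \in A); first by rewrite ComplexField.Normc.normc1.
by rewrite ComplexField.Normc.normc0.
Qed.

(** An upper bound [r] of the indicators must equal 1 on each [A n], hence on the union. *)
Lemma linf_proj_sup_indic (R : realType) (K : choiceType) (A : nat -> set K) :
  linf_proj_sup (fun n x => (x \in A n)%:R : complex R)
    (fun x => (x \in \bigcup_n A n)%:R).
Proof.
split; first exact: linf_proj_indic.
split=> [n x|r _ Ar x].
  have [Ax|Ax] := pselect (A n x).
    by rewrite (mem_set (_ : (\bigcup_n A n) x)) ?mulr1//; exists n.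
  by rewrite memNset// !mul0r.
have [[n _ Ax]|Ax] := pselect ((\bigcup_n A n) x).
  by have := Ar n x; rewrite (mem_set Ax) mem_set//; exists n.
by rewrite memNset// !mul0r.
Qed.

Lemma natr_setU (R : realType) (K : choiceType) (A B : set K) (x : K) :
  A `&` B = set0 ->
  ((x \in A `|` B)%:R = (x \in A)%:R + (x \in B)%:R :> complex R).
Proof.
move=> AB0; rewrite in_setU; case: (boolP (x \in A)) => xA; last by rewrite add0r.
rewrite [in X in _ + X]memNset ?addr0// => xB.
by have : set0 x by rewrite -AB0; split=> //; exact: set_mem.
Qed.

(** * From a regular measure to regular singular states *)

Section MeasureToStates.
Context {R : realType} {K : choiceType}.
Variable mu : set K -> R.
Hypotheses (mu_prob : fa_probability mu) (mu_reg : regular_measure mu)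
  (mu_sing : vanishes_on_singletons mu).
Local Notation C := (complex R).

Definition cintegral (f : K -> C) : C :=
  Complex (integral mu (fun x => complex.Re (f x)))
          (integral mu (fun x => complex.Im (f x))).

Lemma bounded_real_Re (f : K -> C) : linf_bounded f ->
  bounded_real (fun x => complex.Re (f x)).
Proof. by move=> [M fM]; exists M => x; exact: le_trans (norm_Re_le _) (fM x). Qed.

Lemma bounded_real_Im (f : K -> C) : linf_bounded f ->
  bounded_real (fun x => complex.Im (f x)).
Proof. by move=> [M fM]; exists M => x; exact: le_trans (norm_Im_le _) (fM x). Qed.

Lemma cintegral_state : linf_state cintegral.
Proof.
have indic1 : (\1_[set: K] : K -> R) = (fun=> 1) by rewrite indicT.
have integral0 : integral mu (fun=> 0) = 0.
  rewrite (integral_null_support _ mu_prob _ set0)//; last exact: fa_set0.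
  by exists 0 => x; rewrite normr0.
split; [|split].
- move=> [p q] f g bf bg; rewrite /cintegral.
  have := bounded_real_Re _ bf; have := bounded_real_Im _ bf.
  have := bounded_real_Re _ bg; have := bounded_real_Im _ bg.
  set fr := fun x => complex.Re (f x); set fi := fun x => complex.Im (f x).
  set gr := fun x => complex.Re (g x); set gi := fun x => complex.Im (g x).
  move=> bgi bgr bfi bfr.
  have -> : (fun x => complex.Re (Complex p q * f x + g x)) =
      (fun x => p * fr x + (- q) * fi x + gr x).
    by apply/funext => x; rewrite /fr /fi /gr; case: (f x) (g x) => a b [c d] /=; ring.
  have -> : (fun x => complex.Im (Complex p q * f x + g x)) =
      (fun x => p * fi x + q * fr x + gi x).
    by apply/funext => x; rewrite /fr /fi /gi; case: (f x) (g x) => a b [c d] /=; ring.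
  have bD c d (h k : K -> R) : bounded_real h -> bounded_real k ->
      bounded_real (fun x => c * h x + d * k x).
    by move=> bh bk; apply: bounded_realD; exact: bounded_realZ.
  rewrite !(integralD _ mu_prob) ?(integralZ _ mu_prob)//; do ?[exact: bounded_realZ|exact: bD].
  by apply/eqP; rewrite eq_complex /=; apply/andP; split; apply/eqP; ring.
- move=> f bf f0; apply/ge0_complexP; split=> /=.
    rewrite -[RHS]integral0; congr integral; apply/funext => x.
    by case/ge0_complexP: (f0 x).
  apply: integral_ge0 => //; first exact: bounded_real_Re.
  by move=> x; case/ge0_complexP: (f0 x).
- by rewrite /cintegral /= integral0 -indic1 integral_indic// fa_setT.
Qed.

Lemma cintegral_null_support (f : K -> C) A : linf_bounded f -> mu A = 0 ->
  (forall x, ~ A x -> f x = 0) -> cintegral f = 0.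
Proof.
move=> bf A0 fA; rewrite /cintegral !(integral_null_support _ mu_prob _ A)//.
- exact: bounded_real_Im.
- by move=> x /fA ->.
- exact: bounded_real_Re.
- by move=> x /fA ->.
Qed.

(** A nonnegative complex function is real, so it is nonzero exactly where its real part is
    positive, and the real case applies. *)
Lemma cintegral_eq0 (f : K -> C) : linf_bounded f -> (forall x, 0 <= f x) ->
  cintegral f = 0 -> mu [set x | f x != 0] = 0.
Proof.
move=> bf f0 [+ _] => /(integral_eq0 _ mu_prob _ mu_reg (bounded_real_Re _ bf)) H.
rewrite -[RHS]H; last by move=> x; case/ge0_complexP: (f0 x).
congr mu; apply/seteqP; split=> x /= => [fx|].
  have [_ fx0] := ge0_complexP _ (f0 x); rewrite lt_neqAle fx0 andbT eq_sym.
  by apply: contra fx => /eqP fx; rewrite (ge0_Re_eq0 _ (f0 x) fx).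
by apply: contraTneq => ->; rewrite ltxx.
Qed.

(** The supports of the [q n] are null, so their union [A] is null by regularity. The indicator of
    [A] is an upper bound of the [q n], which makes the supremum [p] vanish off [A]. *)
Lemma cintegral_regular : linf_regular cintegral.
Proof.
move=> q qp q0 p [[pb _] [_ pmin]]; pose A := \bigcup_n [set x | q n x != 0].
(* A projection is pointwise [conjc (q n x) * q n x]. *)
have qge0 n x : 0 <= q n x.
  have [_ [qc qq]] := qp n.
  by rewrite -qq -[in X in _ * X]qc; exact: mul_conjc_ge0.
apply: (cintegral_null_support _ A) => //.
  by apply: mu_reg => n; apply: cintegral_eq0 => //; case: (qp n).
have pA : linf_proj_le p (fun x => (x \in A)%:R).
  apply: pmin; first exact: linf_proj_indic.
  move=> n y; have [->|qy] := eqVneq (q n y) 0; first by rewrite mul0r.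
  by rewrite mem_set ?mulr1//; exists n.
by move=> x Ax; have := pA x; rewrite memNset// mulr0.
Qed.

Lemma cintegral_singular : linf_singular cintegral.
Proof.
move=> f fin_f; apply: (cintegral_null_support _ [set x | f x != 0]).
(* Boundedness has to be derived from finite support: the sum of all moduli over the support bounds
   each of them. *)
- exists (\sum_(x <- fset_set [set x | f x != 0]) normc (f x)) => x.
  have [fx|] := eqVneq (f x) 0.
    rewrite fx ComplexField.Normc.normc0; apply: sumr_ge0 => y _.
    exact: normc_ge0.
  move=> fx; rewrite (big_fsetD1 x) /=; last by rewrite in_fset_set// mem_set.
  by rewrite lerDl; apply: sumr_ge0 => y _; exact: normc_ge0.
- by apply: (fa_countable _ mu_prob) => //; exact: finite_set_countable.
- by move=> x /negP; rewrite negbK => /eqP.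
Qed.

Definition diagonal_state (T : @op R K) : C := cintegral (diagonal T).

(** Taking the diagonal is linear, positive and unital from B(l^2(K)) to l^oo(K), so composing it
    with a state gives a state. *)
Lemma diagonal_state_state : B_state diagonal_state.
Proof.
have [lin [pos unit]] := cintegral_state.
split; first by move=> a S T bS bT; apply: lin; exact: diagonal_bounded.
split.
  move=> T bT T0; apply: pos; first exact: diagonal_bounded.
  exact: diagonal_ge0.
rewrite -[RHS]unit; congr cintegral; apply/funext => x; exact: delta_diag.
Qed.

Lemma diagonal_state_regular : B_regular diagonal_state.
Proof.
move=> Q Qp Q0 P PQ.
pose A := \bigcup_n [set x | diagonal (Q n) x != 0].
apply: (cintegral_null_support _ A).
- by apply: diagonal_bounded; case: PQ => -[].
- apply: mu_reg => n; apply: cintegral_eq0; last exact: Q0.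
    by apply: diagonal_bounded; case: (Qp n).
  by move=> x; exact: diagonal_proj_ge0.
move=> x Ax; rewrite /diagonal (proj_sup_delta Q)// => n.
apply: diagonal_proj_eq0 => //; apply: contrapT => /eqP Qx; apply: Ax.
by exists n.
Qed.

Lemma diagonal_state_singular : B_singular diagonal_state.
Proof.
move=> T Tcpt.
apply: (cintegral_null_support _ [set x | 0 < normc (diagonal T x)]).
- by apply: diagonal_bounded; case: Tcpt.
- apply: (fa_levels _ (fun x => normc (diagonal T x)) mu_reg) => e e0.
  apply: (fa_countable _ mu_prob) => //; apply: finite_set_countable.
  exact: diagonal_compact_finite.
- move=> x /negP; rewrite -leNgt => Tx; apply: ComplexField.Normc.eq0_normc.
  by apply/eqP; rewrite eq_le Tx normc_ge0.
Qed.

End MeasureToStates.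

(** * From regular singular states to a regular measure *)

Lemma linf_state_measure (R : realType) (K : choiceType)
    (phi : (K -> complex R) -> complex R) :
  linf_state phi -> linf_regular phi -> linf_singular phi ->
  exists mu : set K -> R,
    [/\ fa_probability mu, regular_measure mu & vanishes_on_singletons mu].
Proof.
move=> [lin [pos unit]] reg sing.
pose chi (A : set K) : K -> complex R := fun x => (x \in A)%:R.
have chib A : linf_bounded (chi A) by case: (linf_proj_indic R K A).
have chi0 A : 0 <= phi (chi A) by apply: pos => // x; exact: natr_bool_ge0.
(* Positivity makes [phi (chi A)] real, so the real part loses nothing; in particular a null set [A]
   has [phi (chi A) = 0]. *)
exists (fun A => complex.Re (phi (chi A))); split.
- split; first by move=> A; case/ge0_complexP: (chi0 A).
  split.
    rewrite (_ : chi setT = (fun=> 1)) ?unit//.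
    by apply/funext => x; rewrite /chi in_setT.
  move=> A B AB0; rewrite -raddfD -[phi (chi A)]mul1r -lin//; congr (complex.Re (phi _)).
  by apply/funext => x; rewrite mul1r; exact: natr_setU.
- move=> A A0; rewrite (reg (fun n => chi (A n)))//.
  + by move=> n; exact: linf_proj_indic.
  + by move=> n; exact: ge0_Re_eq0.
  + exact: linf_proj_sup_indic.
- move=> x; rewrite sing//; apply: sub_finite_set (finite_set1 x) => y /=.
  rewrite /chi; have [//|yx] := pselect (y = x).
  by rewrite memNset ?eqxx.
Qed.

(** Coordinate projections replace indicators. Singletons are null because their coordinate
    projections have rank one and are therefore compact. *)
Lemma B_state_measure (R : realType) (K : choiceType)
    (phi : @op R K -> complex R) :
  B_state phi -> B_regular phi -> B_singular phi ->
  exists mu : set K -> R,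
    [/\ fa_probability mu, regular_measure mu & vanishes_on_singletons mu].
Proof.
move=> [lin [pos unit]] reg sing.
have res0 A : 0 <= phi (restriction A).
  apply: pos; first exact: restriction_bounded.
  by move=> f _; exact: restriction_positive.
exists (fun A => complex.Re (phi (restriction A))); split.
- split; first by move=> A; case/ge0_complexP: (res0 A).
  split.
    rewrite (_ : restriction setT = id) ?unit//.
    by apply/funext => f; apply/funext => x; rewrite /restriction in_setT mul1r.
  move=> A B AB0; rewrite -raddfD -[phi (restriction A)]mul1r -lin;
    [|exact: restriction_bounded|exact: restriction_bounded].
  congr (complex.Re (phi _)); apply/funext => f; apply/funext => x.
  by rewrite mul1r /restriction natr_setU// mulrDl.
- move=> A A0; rewrite (reg (fun n => restriction (A n)))//.
  + by move=> n; exact: restriction_proj.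
  + by move=> n; exact: ge0_Re_eq0.
  + exact: restriction_sup.
- by move=> x; rewrite sing//; exact: restriction1_compact.
Qed.

Theorem theorem8p2 (R : realType) (K : choiceType)
  (Kuncount : ~ countable [set: K]) :
  [/\ ((exists mu : set K -> R,
          [/\ fa_probability mu, regular_measure mu
            & vanishes_on_singletons mu]) <->
       (exists phi : (K -> complex R) -> complex R,
          [/\ linf_state phi, linf_regular phi & linf_singular phi])),
      ((exists phi : (K -> complex R) -> complex R,
          [/\ linf_state phi, linf_regular phi & linf_singular phi]) <->
       (exists phi : @op R K -> complex R,
          [/\ B_state phi, B_regular phi & B_singular phi]))
    & ((exists mu : set K -> R,
          [/\ fa_probability mu, regular_measure mu
            & vanishes_on_singletons mu]) <->
       (exists phi : @op R K -> complex R,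
          [/\ B_state phi, B_regular phi & B_singular phi]))].
Proof.
set P1 := exists mu, _; set P2 := exists phi, _; set P3 := exists phi, _.
have P12 : P1 -> P2.
  move=> [mu [mup mur mus]]; exists (cintegral mu); split.
  - exact: cintegral_state.
  - exact: cintegral_regular.
  - exact: cintegral_singular.
have P13 : P1 -> P3.
  move=> [mu [mup mur mus]]; exists (diagonal_state mu); split.
  - exact: diagonal_state_state.
  - exact: diagonal_state_regular.
  - exact: diagonal_state_singular.
have P21 : P2 -> P1 by move=> [phi [ps pr psing]]; exact: linf_state_measure ps pr psing.
have P31 : P3 -> P1 by move=> [phi [ps pr psing]]; exact: B_state_measure ps pr psing.
(* The two statements about states are linked through the measure. *)
by split; split=> // [/P21/P13|/P31/P12].
Qed.
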